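(* Let $b\ge1$. For general $b\times b$ matrices $B_1,B_2$ over $k$, define the representations $N_1$ (of dimension $(3b,3b)$) and $N_2$ (of dimension $(6b,3b)$) of the $3$-arrow Kronecker quiver $K_3$ by the block matrices $$N_1(a_1)=\begin{pmatrix}0&-B_1&0\\0&0&B_1\\0&0&0\end{pmatrix},\quad N_1(a_2)=\begin{pmatrix}B_1&0&0\\0&0&0\\0&0&-B_1\end{pmatrix},\quad N_1(a_3)=\begin{pmatrix}0&0&0\\-B_1&0&0\\0&B_1&0\end{pmatrix},$$ $$N_2(a_1)=\begin{pmatrix}0&B_2&0\\0&0&B_2\\0&0&0\\ B_2&0&0\\0&0&0\\0&0&0\end{pmatrix},\quad N_2(a_2)=\begin{pmatrix}B_2&0&0\\0&0&0\\0&0&B_2\\0&0&0\\0&B_2&0\\0&0&0\end{pmatrix},\quad N_2(a_3)=\begin{pmatrix}0&0&0\\ B_2&0&0\\0&B_2&0\\0&0&0\\0&0&0\\0&0&B_2\end{pmatrix}.$$ Then, for every $a\ge1$, $c_{N_1}$ is a semi-invariant function for the tensors of size $a\times2a\times3$, and $c_{N_2}$ is a semi-invariant function for the tensors of size $a\times a\times 3$.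
   Context: $k$ is a field of characteristic $0$. $K_n$ is the quiver with vertices $1,2$ and $n$ arrows $a_1,\dots,a_n$ from $1$ to $2$. Vectors are row vectors, so a representation $M$ of $K_n$ of dimension $(\alpha_1,\alpha_2)$ is an $n$-tuple of $\alpha_1\times\alpha_2$ matrices $M(a_i)$, acting by right multiplication on row vectors. The space $\mathrm{Rep}_\alpha(K_n)$ is identified with the space of tensors $U^*\otimes V\otimes W^*$ of size $\alpha_1\times\alpha_2\times n$, $\dim(U,V,W)=(\alpha_1,\alpha_2,n)$, where $W$ is the span of the arrows. $\mathrm{GL}_\alpha=\mathrm{GL}_{\alpha_1}\times\mathrm{GL}_{\alpha_2}$ acts by base change and $G=\mathrm{GL}(W)=\mathrm{GL}_n$ acts through its natural action on the span of arrows, $(gM)(a)=M(g^{-1}a)$ ($M$ extended linearly to the span of arrows). A semi-invariant function for the tensors of size $\alpha_1\times\alpha_2\times n$ is a function $f\in k[\mathrm{Rep}_\alpha(K_n)]$ that is semi-invariant for $\mathrm{GL}_\alpha\times G$, i.e. $g\cdot f=\chi(g)f$ for some character $\chi$ (so $f$ is invariant under $\mathrm{SL}(U)\times\mathrm{SL}(V)\times\mathrm{SL}(W)$). Euler form: $\langle\alpha,\beta\rangle=\alpha_1\beta_1+\alpha_2\beta_2-n\alpha_1\beta_2$. For $M,N$ of dimension $\alpha,\beta$ with $\langle\alpha,\beta\rangle=0$, take an injective resolution $0\to N\to I_0\to I_1\to0$ and set $c_N(M)=c(M,N)=\det\big(\mathrm{Hom}(M,I_0)\to\mathrm{Hom}(M,I_1)\big)$,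 well defined up to a nonzero constant; $c_N$ is viewed as a function on $\mathrm{Rep}_\alpha(K_n)$. ''General'' means: in a nonempty Zariski open subset. *)

(* Defs.v *)
From HB Require Import structures.
From mathcomp Require Import all_boot all_order all_algebra.
From mathcomp Require Import mpoly.

Set Implicit Arguments.
Unset Strict Implicit.
Unset Printing Implicit Defensive.

Import Order.TTheory GRing.Theory Num.Theory.
Local Open Scope ring_scope.

(* A set [T] is viewed as an affine space through a coordinate system
   [x : T -> I -> k] with [I] finite.  Fields of characteristic 0 are infinite,
   so working with k-points loses nothing. *)

Definition peval (k : fieldType) (I : finType) (p : {mpoly k[#|I|]})
    (x : I -> k) : k :=
  p.@[fun j => x (enum_val j)].

Definition zariski_open (k : fieldType) (T : Type) (I : finType)
    (x : T -> I -> k) (U : T -> Prop) : Prop :=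
  exists S : {mpoly k[#|I|]} -> Prop,
    forall t, U t <-> (exists p, S p /\ peval p (x t) <> 0).

Definition for_general (k : fieldType) (T : Type) (I : finType)
    (x : T -> I -> k) (P : T -> Prop) : Prop :=
  exists U : T -> Prop,
    [/\ zariski_open x U, exists t, U t & forall t, U t -> P t].

(* Representations of the n-arrow Kronecker quiver 1 -> 2: matrices act on row
   vectors by right multiplication. *)

Notation rep k n a1 a2 := {ffun 'I_n -> 'M[k]_(a1, a2)}.

Definition euler_form (n a1 a2 b1 b2 : nat) : int :=
  a1%:Z * b1%:Z + a2%:Z * b2%:Z - n%:Z * a1%:Z * b2%:Z.

Notation vmap k a1 a2 b1 b2 := ('M[k]_(a1, b1) * 'M[k]_(a2, b2))%type.

Definition is_hom (k : fieldType) (n a1 a2 b1 b2 : nat)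
    (M : rep k n a1 a2) (N : rep k n b1 b2) (f : vmap k a1 a2 b1 b2) : Prop :=
  forall i, M i *m f.2 = f.1 *m N i.

(* In diagrammatic order: [f] first, then [g]. *)
Definition vcomp (k : fieldType) (a1 a2 b1 b2 c1 c2 : nat)
    (f : vmap k a1 a2 b1 b2) (g : vmap k b1 b2 c1 c2) : vmap k a1 a2 c1 c2 :=
  (f.1 *m g.1, f.2 *m g.2).

Definition vid (k : fieldType) (a1 a2 : nat) : vmap k a1 a2 a1 a2 :=
  (1%:M, 1%:M).

Definition vinjective (k : fieldType) (a1 a2 b1 b2 : nat)
    (f : vmap k a1 a2 b1 b2) : Prop :=
  row_free f.1 /\ row_free f.2.

Definition vsurjective (k : fieldType) (a1 a2 b1 b2 : nat)
    (f : vmap k a1 a2 b1 b2) : Prop :=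
  row_full f.1 /\ row_full f.2.

Definition vexact (k : fieldType) (a1 a2 b1 b2 c1 c2 : nat)
    (f : vmap k a1 a2 b1 b2) (g : vmap k b1 b2 c1 c2) : Prop :=
  (f.1 :=: kermx g.1)%MS /\ (f.2 :=: kermx g.2)%MS.

Definition is_isom (k : fieldType) (n a1 a2 b1 b2 : nat)
    (M : rep k n a1 a2) (N : rep k n b1 b2)
    (f : vmap k a1 a2 b1 b2) (g : vmap k b1 b2 a1 a2) : Prop :=
  [/\ is_hom M N f, is_hom N M g,
      vcomp f g = vid k a1 a2 & vcomp g f = vid k b1 b2].

Definition is_injective_rep (k : fieldType) (n d1 d2 : nat)
    (I : rep k n d1 d2) : Prop :=
  forall (x1 x2 y1 y2 : nat) (X : rep k n x1 x2) (Y : rep k n y1 y2)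
         (i : vmap k x1 x2 y1 y2) (f : vmap k x1 x2 d1 d2),
    is_hom X Y i -> vinjective i -> is_hom X I f ->
    exists g, is_hom Y I g /\ vcomp i g = f.

Definition is_injective_resolution (k : fieldType) (n b1 b2 c1 c2 d1 d2 : nat)
    (N : rep k n b1 b2) (I0 : rep k n c1 c2) (I1 : rep k n d1 d2)
    (iota : vmap k b1 b2 c1 c2) (pi : vmap k c1 c2 d1 d2) : Prop :=
  [/\ is_injective_rep I0 /\ is_injective_rep I1,
      is_hom N I0 iota /\ is_hom I0 I1 pi
    & [/\ vinjective iota, vexact iota pi & vsurjective pi]].

(* The indecomposable injectives are E_1 = (k -> 0) and E_2 = (k^n -> k), in
   which a_i acts as the i-th coordinate.  [std_inj p q] is E_1^p + E_2^q; every
   finite-dimensional injective is isomorphic to exactly one of these. *)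

Definition std_inj (k : fieldType) (n p q : nat) :
    rep k n (p + \sum_(j < n) q) q :=
  [ffun i => col_mx 0 (\mxcol_(j < n) ((j == i)%:R%:M : 'M[k]_q))].

(* Hom(M, E_1^p + E_2^q) = Hom(M(1), k^p) + Hom(M(2), k^q), naturally in M:
   [std_hom] sends the pair of components to the morphism, and [std_components]
   is its inverse. *)
Definition std_hom (k : fieldType) (n a1 a2 p q : nat) (M : rep k n a1 a2)
    (A : vmap k a1 a2 p q) : vmap k a1 a2 (p + \sum_(j < n) q) q :=
  (row_mx A.1 (\mxrow_(j < n) (M j *m A.2)), A.2).

Definition std_components (k : fieldType) (n a1 a2 p q : nat)
    (f : vmap k a1 a2 (p + \sum_(j < n) q) q) : vmap k a1 a2 p q :=
  (lsubmx f.1, f.2).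

Definition vmap_row (k : fieldType) (a1 a2 p q : nat) (A : vmap k a1 a2 p q) :
    'rV[k]_(a1 * p + a2 * q) :=
  row_mx (mxvec A.1) (mxvec A.2).

Definition row_vmap (k : fieldType) (a1 a2 p q : nat)
    (v : 'rV[k]_(a1 * p + a2 * q)) : vmap k a1 a2 p q :=
  (vec_mx (lsubmx v), vec_mx (rsubmx v)).

Lemma row_vmapK (k : fieldType) (a1 a2 p q : nat) :
  cancel (@row_vmap k a1 a2 p q) (@vmap_row k a1 a2 p q).
Proof. by move=> v; rewrite /vmap_row /= !vec_mxK hsubmxK. Qed.

Lemma vmap_rowK (k : fieldType) (a1 a2 p q : nat) :
  cancel (@vmap_row k a1 a2 p q) (@row_vmap k a1 a2 p q).
Proof.
by case=> A B; rewrite /row_vmap /vmap_row /= row_mxKl row_mxKr !mxvecK.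
Qed.

Lemma mul_std_inj (k : fieldType) (n m p q : nat) (A : 'M[k]_(m, p))
    (B : forall j : 'I_n, 'M[k]_(m, q)) (i : 'I_n) :
  row_mx A (\mxrow_(j < n) B j) *m std_inj k n p q i = B i.
Proof.
rewrite ffunE mul_row_col mulmx0 add0r mul_mxrow_mxcol (bigD1 i) //= eqxx.
rewrite mulmx1 big1 ?addr0 // => j /negPf ->.
by rewrite -scalemx1 scale0r mulmx0.
Qed.

Lemma std_hom_is_hom (k : fieldType) (n a1 a2 p q : nat) (M : rep k n a1 a2)
    (A : vmap k a1 a2 p q) :
  is_hom M (std_inj k n p q) (std_hom M A).
Proof. by move=> i; rewrite mul_std_inj. Qed.

Lemma std_homK (k : fieldType) (n a1 a2 p q : nat) (M : rep k n a1 a2) :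
  cancel (@std_hom k n a1 a2 p q M) (@std_components k n a1 a2 p q).
Proof. by case=> A B; rewrite /std_components /= row_mxKl. Qed.

Lemma std_componentsK (k : fieldType) (n a1 a2 p q : nat) (M : rep k n a1 a2)
    (f : vmap k a1 a2 (p + \sum_(j < n) q) q) :
  is_hom M (std_inj k n p q) f -> std_hom M (std_components f) = f.
Proof.
case: f => f1 f2 fM; rewrite /std_hom /=; congr pair.
rewrite -[RHS]hsubmxK; congr row_mx.
rewrite -[RHS]submxrowK; apply/eq_mxrow => i.
by rewrite fM /= -{1}[f1]hsubmxK -[rsubmx f1]submxrowK mul_std_inj mxrowK.
Qed.

Lemma std_inj_injective (k : fieldType) (n p q : nat) :
  is_injective_rep (std_inj k n p q).
Proof.
move=> x1 x2 y1 y2 X Y i f iXY [i1 i2] fX.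
pose A := std_components f.
pose g := std_hom Y (pinvmx i.1 *m A.1, pinvmx i.2 *m A.2).
have gY : is_hom Y (std_inj k n p q) g by apply: std_hom_is_hom.
exists g; split=> //.
have igX : is_hom X (std_inj k n p q) (vcomp i g).
  by move=> j; rewrite mulmxA iXY -!mulmxA; congr (_ *m _); apply: gY.
rewrite -(std_componentsK igX) -(std_componentsK fX); congr std_hom.
rewrite /std_components; congr pair => /=.
  by rewrite mul_mx_row row_mxKl mulmxA mulmxVp // mul1mx.
by rewrite mulmxA mulmxVp // mul1mx.
Qed.

(* [hom_mx M t0' pi t1] is the matrix of Hom(M, I0) -> Hom(M, I1) induced by
   [pi].  The bases come from isomorphisms t0, t1 of I0, I1 with standard
   injectives, where t0' is the inverse of t0. *)

Definition hom_mx (k : fieldType) (n a1 a2 c1 c2 d1 d2 p0 q0 p1 q1 : nat)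
    (M : rep k n a1 a2)
    (t0' : vmap k (p0 + \sum_(j < n) q0) q0 c1 c2) (pi : vmap k c1 c2 d1 d2)
    (t1 : vmap k d1 d2 (p1 + \sum_(j < n) q1) q1) :
    'M[k]_(a1 * p0 + a2 * q0, a1 * p1 + a2 * q1) :=
  lin1_mx (fun v =>
    vmap_row (std_components
      (vcomp (vcomp (vcomp (std_hom M (row_vmap v)) t0') pi) t1))).

(* [f] is one of the functions c_N on Rep_(a1, a2): some choice of an injective
   resolution of [N] and of bases gives [f].  The basis of Hom(M, I) comes from
   one fixed isomorphism of I with a standard injective, the same for all M, so
   that f is determined up to a nonzero constant and not merely pointwise.
   The equality [e] of the dimensions of Hom(M, I0) and Hom(M, I1) amounts to
   <(a1, a2), (b1, b2)> = 0. *)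
Definition is_schofield (k : fieldType) (n a1 a2 b1 b2 : nat)
    (N : rep k n b1 b2) (f : rep k n a1 a2 -> k) : Prop :=
  exists (c1 c2 d1 d2 : nat) (I0 : rep k n c1 c2) (I1 : rep k n d1 d2)
         (iota : vmap k b1 b2 c1 c2) (pi : vmap k c1 c2 d1 d2),
    is_injective_resolution N I0 I1 iota pi /\
  exists (p0 q0 p1 q1 : nat)
         (t0 : vmap k c1 c2 (p0 + \sum_(j < n) q0) q0)
         (t0' : vmap k (p0 + \sum_(j < n) q0) q0 c1 c2)
         (t1 : vmap k d1 d2 (p1 + \sum_(j < n) q1) q1)
         (t1' : vmap k (p1 + \sum_(j < n) q1) q1 d1 d2),
    [/\ is_isom I0 (std_inj k n p0 q0) t0 t0',
        is_isom I1 (std_inj k n p1 q1) t1 t1'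
      & exists e : (a1 * p1 + a2 * q1 = a1 * p0 + a2 * q0)%N,
          forall M, f M = \det (castmx (erefl, e) (hom_mx M t0' pi t1))].

(* The canonical resolution 0 -> N -> E_1^b1 + E_2^b2 -> E_1^(n b2) -> 0. *)
Lemma schofield_exists (k : fieldType) (n a1 a2 b1 b2 : nat)
    (N : rep k n b1 b2) :
  euler_form n a1 a2 b1 b2 = 0 ->
  exists f : rep k n a1 a2 -> k, is_schofield N f.
Proof.
move=> eu.
pose s := (\sum_(j < n) b2)%N.
have e : (a1 * s + a2 * 0 = a1 * b1 + a2 * b2)%N.
  have sE : s = (n * b2)%N by rewrite /s sum_nat_const card_ord.
  rewrite sE muln0 addn0; apply/eqP; rewrite -eqz_nat.
  move/eqP: eu; rewrite subr_eq0 => /eqP eu.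
  by rewrite PoszD !PoszM eu mulrCA mulrA.
pose iota : vmap k b1 b2 (b1 + s) b2 := std_hom N (vid k b1 b2).
pose nu : 'M[k]_(b1, s) := \mxrow_(j < n) N j.
pose z := (\sum_(j < n) 0)%N.
have z0 : z = 0%N by rewrite /z big1.
pose pi : vmap k (b1 + s) b2 (s + z) 0 :=
  (row_mx (col_mx (- nu) 1%:M) 0, 0).
have iotaE : iota = (row_mx 1%:M nu, 1%:M).
  rewrite /iota /std_hom /=; congr (row_mx _ _, _).
  by apply: eq_mxrow => j; rewrite mulmx1.
have full1 : row_full pi.1.
  apply/row_fullP; exists (col_mx (row_mx 0 1%:M) 0).
  rewrite /pi /= mul_col_row mul_row_col mul0mx add0r mulmx1 !mulmx0 !mul0mx.
  have -> : (0 : 'M[k]_z) = 1%:M.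
    by apply/matrixP => i; have := ltn_ord i; rewrite {2}z0.
  by rewrite -scalar_mx_block.
have comp0 : iota.1 *m pi.1 = 0.
  rewrite iotaE /pi /= mul_mx_row mulmx0 mul_row_col mul1mx mulmx1 addNr.
  by rewrite row_mx0.
have free1 : row_free iota.1.
  apply/row_freeP; exists (col_mx 1%:M 0).
  by rewrite iotaE /= mul_row_col mulmx1 mulmx0 addr0.
exists (fun M => \det (castmx (erefl, e)
  (hom_mx (p0 := b1) (q0 := b2) (p1 := s) (q1 := 0)
    M (vid k _ _) pi (vid k _ _)))).
exists (b1 + s)%N, b2, (s + z)%N, 0%N, (std_inj k n b1 b2), (std_inj k n s 0).
exists iota, pi; split.
  split; first by split; apply: std_inj_injective.
    split; first exact: std_hom_is_hom.
    by move=> i; rewrite mulmx0; apply/matrixP => ? [].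
  split.
  - by split=> //; rewrite iotaE /= row_free_unit unitmx1.
  - split.
      apply/eqmxP; rewrite -mxrank_leqif_eq; last exact/sub_kermxP.
      by rewrite mxrank_ker (eqP full1) (eqP free1) z0 addn0 addnK.
    rewrite iotaE /=; apply/eqmxP; rewrite -mxrank_leqif_eq.
      by rewrite mxrank_ker mxrank0 subn0 mxrank1.
    by apply/sub_kermxP; rewrite mulmx0.
  - by split=> //; rewrite /row_full /= mxrank0.
have idP p q : is_isom (std_inj k n p q) (std_inj k n p q) (vid k _ _) (vid k _ _).
  by split=> [i|i||]; rewrite /vcomp /= ?mulmx1 ?mul1mx.
exists b1, b2, s, 0%N, (vid k _ _), (vid k _ _), (vid k _ _), (vid k _ _).
by split; [apply: idP | apply: idP | exists e].
Qed.

Notation glt k a1 a2 n := ('M[k]_a1 * 'M[k]_a2 * 'M[k]_n)%type.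

Definition in_gl (k : fieldType) (a1 a2 n : nat) (g : glt k a1 a2 n) : bool :=
  [&& g.1.1 \in unitmx, g.1.2 \in unitmx & g.2 \in unitmx].

Definition gl_mul (k : fieldType) (a1 a2 n : nat) (g h : glt k a1 a2 n) :
    glt k a1 a2 n :=
  (g.1.1 *m h.1.1, g.1.2 *m h.1.2, g.2 *m h.2).

Definition gl_inv (k : fieldType) (a1 a2 n : nat) (g : glt k a1 a2 n) :
    glt k a1 a2 n :=
  (invmx g.1.1, invmx g.1.2, invmx g.2).

(* GL_(a1, a2) acts by base change, and h in GL_n by (hM)(a) = M(h^-1 a), where
   h a_i = \sum_j h_ji a_j. *)
Definition rep_act (k : fieldType) (a1 a2 n : nat) (g : glt k a1 a2 n)
    (M : rep k n a1 a2) : rep k n a1 a2 :=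
  [ffun i =>
     g.1.1 *m (\sum_(j < n) invmx g.2 j i *: M j) *m invmx g.1.2].

Definition fun_act (k : fieldType) (a1 a2 n : nat) (g : glt k a1 a2 n)
    (f : rep k n a1 a2 -> k) : rep k n a1 a2 -> k :=
  fun M => f (rep_act (gl_inv g) M).

Definition rep_coord (k : fieldType) (n a1 a2 : nat) (M : rep k n a1 a2)
    (t : 'I_n * 'I_a1 * 'I_a2) : k :=
  M t.1.1 t.1.2 t.2.

Definition glt_coord (k : fieldType) (a1 a2 n : nat) (g : glt k a1 a2 n)
    (t : ('I_a1 * 'I_a1) + ('I_a2 * 'I_a2) + ('I_n * 'I_n)) : k :=
  match t with
  | inl (inl (i, j)) => g.1.1 i j
  | inl (inr (i, j)) => g.1.2 i j
  | inr (i, j) => g.2 i j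
  end.

(* A character of the algebraic group, hence a regular function: a polynomial
   in the entries divided by a power of the determinants. *)
Definition is_character (k : fieldType) (a1 a2 n : nat)
    (chi : glt k a1 a2 n -> k) : Prop :=
  [/\ forall g, in_gl g -> chi g <> 0,
      forall g h, in_gl g -> in_gl h -> chi (gl_mul g h) = chi g * chi h
    & exists (p : {mpoly k[#|{: ('I_a1 * 'I_a1) + ('I_a2 * 'I_a2)
                               + ('I_n * 'I_n)}|]}) (m : nat),
        forall g, in_gl g ->
          chi g = peval p (glt_coord g)
                    / (\det g.1.1 * \det g.1.2 * \det g.2) ^+ m].

Definition is_polynomial_fun (k : fieldType) (n a1 a2 : nat)
    (f : rep k n a1 a2 -> k) : Prop :=
  exists p : {mpoly k[#|{: 'I_n * 'I_a1 * 'I_a2}|]},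
    forall M, f M = peval p (rep_coord M).

Definition semi_invariant (k : fieldType) (n a1 a2 : nat)
    (f : rep k n a1 a2 -> k) : Prop :=
  is_polynomial_fun f /\
  exists chi : glt k a1 a2 n -> k, is_character chi /\
    forall g, in_gl g -> forall M, fun_act g f M = chi g * f M.

Definition row3 (k : fieldType) (b : nat) (X Y Z : 'M[k]_b) :
    'M[k]_(b, b + (b + b)) :=
  row_mx X (row_mx Y Z).

Definition col3 (k : fieldType) (b c : nat) (X Y Z : 'M[k]_(b, c)) :
    'M[k]_(b + (b + b), c) :=
  col_mx X (col_mx Y Z).

Definition col6 (k : fieldType) (b c : nat) (X Y Z S T U : 'M[k]_(b, c)) :
    'M[k]_(b + (b + (b + (b + (b + b)))), c) :=
  col_mx X (col_mx Y (col_mx Z (col_mx S (col_mx T U)))).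

Definition N1 (k : fieldType) (b : nat) (B : 'M[k]_b) :
    rep k 3 (b + (b + b)) (b + (b + b)) :=
  [ffun i : 'I_3 =>
    [:: col3 (row3 0 (- B) 0)
             (row3 0   0   B)
             (row3 0   0   0);
        col3 (row3 B   0   0)
             (row3 0   0   0)
             (row3 0   0 (- B));
        col3 (row3   0   0 0)
             (row3 (- B) 0 0)
             (row3   0   B 0)]`_i].

Definition N2 (k : fieldType) (b : nat) (B : 'M[k]_b) :
    rep k 3 (b + (b + (b + (b + (b + b))))) (b + (b + b)) :=
  [ffun i : 'I_3 =>
    [:: col6 (row3 0 B 0)
             (row3 0 0 B)
             (row3 0 0 0)
             (row3 B 0 0)
             (row3 0 0 0)
             (row3 0 0 0);
        col6 (row3 B 0 0)
             (row3 0 0 0)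
             (row3 0 0 B)
             (row3 0 0 0)
             (row3 0 B 0)
             (row3 0 0 0);
        col6 (row3 0 0 0)
             (row3 B 0 0)
             (row3 0 B 0)
             (row3 0 0 0)
             (row3 0 0 0)
             (row3 0 0 B)]`_i].

Definition pair_coord (k : fieldType) (b : nat) (B : 'M[k]_b * 'M[k]_b)
    (t : ('I_b * 'I_b) + ('I_b * 'I_b)) : k :=
  match t with
  | inl (i, j) => B.1 i j
  | inr (i, j) => B.2 i j
  end.

(* Main.v *)
Require Import Defs.
From HB Require Import structures.
From mathcomp Require Import all_boot all_order all_algebra.
From mathcomp Require Import mpoly ring.
From Stdlib Require Classical_Prop.

Set Implicit Arguments.
Unset Strict Implicit.
Unset Printing Implicit Defensive.

Import GRing.Theory.
Local Open Scope ring_scope.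

(** A function c_N on Rep_(a1, a2) is the determinant of the matrix
    [std_mx M pi] of Hom(M, pi), for a resolution pi : I0 -> I1 of N by standard
    injectives.
    For two such resolutions pi, pi' of N with the same terms, the comparison
    maps and a homotopy assemble into a map
    theta : I0 + I1' -> I0' + I1 with
    det Hom(M, pi) = +- det Hom(M, theta) det Hom(M, pi'), and det Hom(M, theta)
    does not depend on M because Hom(M, theta) is block triangular with
    only the off-diagonal block depending on M.  So the determinants of two
    resolutions are proportional.

    Now N_1 = (skew 3x3 matrices -> k^3) (x) B_1 and
    N_2 = (symmetric 3x3 matrices -> k^3) (x) B_2, where a_i sends S to its i-th
    row, and S |-> X^T S X shows that both are isomorphic to all their twists by
    X in GL_3.  Twisting a resolution therefore changes c_N by a nonzero scalar,
    and base change multiplies it by constant determinants.  Hence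
    c(g^-1 M) = chi(g) c(M) with chi(g) = c(g^-1 M0) / c(M0), which is a
    regular function of g. *)

(** * Resolutions *)

Lemma mulmx_rV_inj (k : fieldType) (m n : nat) (A B : 'M[k]_(m, n)) :
  (forall v : 'rV_m, v *m A = v *m B) -> A = B.
Proof. by move=> AB; apply/row_matrixP => i; rewrite !rowE. Qed.

Section VertexwiseAlgebra.

Variable k : fieldType.

Lemma vcompA (a1 a2 b1 b2 c1 c2 d1 d2 : nat) (f : vmap k a1 a2 b1 b2)
    (g : vmap k b1 b2 c1 c2) (h : vmap k c1 c2 d1 d2) :
  vcomp f (vcomp g h) = vcomp (vcomp f g) h.
Proof. by rewrite /vcomp /= !mulmxA. Qed.

Lemma vcomp1r (a1 a2 b1 b2 : nat) (f : vmap k a1 a2 b1 b2) :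
  vcomp f (vid k b1 b2) = f.
Proof. by case: f => f1 f2; rewrite /vcomp /= !mulmx1. Qed.

Lemma vcomp1l (a1 a2 b1 b2 : nat) (f : vmap k a1 a2 b1 b2) :
  vcomp (vid k a1 a2) f = f.
Proof. by case: f => f1 f2; rewrite /vcomp /= !mul1mx. Qed.

Lemma vcompBr (a1 a2 b1 b2 c1 c2 : nat) (f : vmap k a1 a2 b1 b2)
    (g h : vmap k b1 b2 c1 c2) :
  vcomp f (g - h) = vcomp f g - vcomp f h.
Proof. by rewrite /vcomp /= !mulmxBr. Qed.

Lemma vcompBl (a1 a2 b1 b2 c1 c2 : nat) (f g : vmap k a1 a2 b1 b2)
    (h : vmap k b1 b2 c1 c2) :
  vcomp (f - g) h = vcomp f h - vcomp g h.
Proof. by rewrite /vcomp /= !mulmxBl. Qed.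

Lemma vcomp_surj_inj (a1 a2 b1 b2 c1 c2 : nat) (f : vmap k a1 a2 b1 b2)
    (g h : vmap k b1 b2 c1 c2) :
  vsurjective f -> vcomp f g = vcomp f h -> g = h.
Proof.
case: g h => g1 g2 [h1 h2] [f1 f2] [] /(row_full_inj f1) -> .
by move=> /(row_full_inj f2) ->.
Qed.

Variable n : nat.

Lemma is_hom_comp (a1 a2 b1 b2 c1 c2 : nat) (M : rep k n a1 a2)
    (N : rep k n b1 b2) (L : rep k n c1 c2) f g :
  is_hom M N f -> is_hom N L g -> is_hom M L (vcomp f g).
Proof. by move=> fMN gNL i; rewrite /= mulmxA fMN -!mulmxA gNL. Qed.

Lemma is_hom_id (a1 a2 : nat) (M : rep k n a1 a2) : is_hom M M (vid k a1 a2).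
Proof. by move=> i; rewrite mulmx1 mul1mx. Qed.

Lemma is_homB (a1 a2 b1 b2 : nat) (M : rep k n a1 a2)
    (N : rep k n b1 b2) f g :
  is_hom M N f -> is_hom M N g -> is_hom M N (f - g).
Proof. by move=> fMN gMN i; rewrite /= mulmxBr mulmxBl fMN gMN. Qed.

End VertexwiseAlgebra.

Section HomologicalAlgebra.

Variables (k : fieldType) (n : nat).

(** The rows of [P *m pinvmx P - 1%:M] are killed by [P], so they lie in the row space of [A], where
    [F] vanishes. *)
Lemma factor_mx (b c d j : nat) (A : 'M[k]_(b, c)) (P : 'M[k]_(c, d))
    (F : 'M[k]_(c, j)) :
  (A :=: kermx P)%MS -> A *m F = 0 -> P *m (pinvmx P *m F) = F.
Proof.
move=> AP AF; apply/eqP; rewrite mulmxA -subr_eq0 -[X in _ - X]mul1mx -mulmxBl.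
have /submxP[Y ->] : (P *m pinvmx P - 1%:M <= A)%MS.
  by rewrite AP; apply/sub_kermxP; rewrite mulmxBl mul1mx mulmxKpV ?subrr.
by rewrite -mulmxA AF mulmx0.
Qed.

Lemma factor_resolution (b1 b2 c1 c2 d1 d2 j1 j2 : nat) (N : rep k n b1 b2)
    (I0 : rep k n c1 c2) (I1 : rep k n d1 d2) (J : rep k n j1 j2) iota pi f :
  is_injective_resolution N I0 I1 iota pi -> is_hom I0 J f ->
  vcomp iota f = 0 -> exists2 g, is_hom I1 J g & vcomp pi g = f.
Proof.
move=> [_ [_ piI] [_ [ex1 ex2] [fu1 fu2]]] fJ [if1 if2].
have := factor_mx ex1 if1; have := factor_mx ex2 if2.
move: (pinvmx pi.1) (pinvmx pi.2) => Y1 Y2 pg2 pg1.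
exists (Y1 *m f.1, Y2 *m f.2); last first.
  by rewrite /vcomp /= pg1 pg2; case: f {fJ if1 if2 pg1 pg2}.
(* The factor is built one vertex at a time; commutation with the arrows can be tested after
   composing with the surjection [pi]. *)
move=> i; apply: (row_full_inj fu1) => /=.
by rewrite !mulmxA -piI -!mulmxA pg2 fJ -{1}pg1 !mulmxA.
Qed.

(** Injectivity of [J0] extends [iota'] along [iota] to [phi0]; then [vcomp phi0 pi'] kills [iota],
    so it factors through [pi]. *)
Lemma comparison (b1 b2 c1 c2 d1 d2 c1' c2' d1' d2' : nat) (N : rep k n b1 b2)
    (I0 : rep k n c1 c2) (I1 : rep k n d1 d2)
    (J0 : rep k n c1' c2') (J1 : rep k n d1' d2') iota pi iota' pi' :
  is_injective_resolution N I0 I1 iota pi ->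
  is_injective_resolution N J0 J1 iota' pi' ->
  exists phi0 phi1, [/\ is_hom I0 J0 phi0, is_hom I1 J1 phi1,
    vcomp iota phi0 = iota' & vcomp pi phi1 = vcomp phi0 pi'].
Proof.
move=> res [[J0i J1i] [iota'J pi'J] [_ [ex1 ex2] _]].
have [_ [iotaI _] [inj _ _]] := res.
have [phi0 [phi0J phi0E]] := J0i _ _ _ _ _ _ _ _ iotaI inj iota'J.
have [|phi1 phi1J phi1E] := factor_resolution res (is_hom_comp phi0J pi'J).
  rewrite vcompA phi0E; congr pair => /=; apply/sub_kermxP.
    by rewrite ex1.
  by rewrite ex2.
by exists phi0, phi1.
Qed.

(* The last equation is one half of the homotopy between [psi phi] and the
   identity of the second resolution. *)
Lemma comparison_homotopy (b1 b2 c1 c2 d1 d2 c1' c2' d1' d2' : nat)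
    (N : rep k n b1 b2) (I0 : rep k n c1 c2) (I1 : rep k n d1 d2)
    (J0 : rep k n c1' c2') (J1 : rep k n d1' d2') iota pi iota' pi' :
  is_injective_resolution N I0 I1 iota pi ->
  is_injective_resolution N J0 J1 iota' pi' ->
  exists phi0 phi1 psi1 s,
  [/\ [/\ is_hom I0 J0 phi0, is_hom I1 J1 phi1, is_hom J1 I1 psi1
       & is_hom J1 J0 s],
      vcomp pi phi1 = vcomp phi0 pi'
    & vid k d1' d2' - vcomp psi1 phi1 = vcomp s pi'].
Proof.
move=> res res'.
have [phi0 [phi1 [h0 h1 iphi0 piphi1]]] := comparison res res'.
have [psi0 [psi1 [h0' h1' ipsi0 pi'psi1]]] := comparison res' res.
have [_ _ [_ _ pi'surj]] := res'.
have homJ0 := is_homB (is_hom_id J0) (is_hom_comp h0' h0).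
(* In diagrammatic order, 1 - psi0 phi0 kills [iota'], hence equals pi' s for a morphism s. *)
have [|s sJ sE] := factor_resolution res' homJ0.
  by rewrite vcompBr vcomp1r vcompA ipsi0 iphi0 subrr.
exists phi0, phi1, psi1, s; split=> //.
(* pi' (1 - psi1 phi1) = (1 - psi0 phi0) pi' = pi' s pi', and the surjection pi' cancels on the
   left. *)
apply: (vcomp_surj_inj pi'surj).
rewrite vcompA sE vcompBr vcompBl vcomp1r vcomp1l.
by rewrite !vcompA pi'psi1 -!vcompA piphi1.
Qed.

End HomologicalAlgebra.

(** * Matrices of Hom(M, f) for f between standard injectives *)

Section HomMatrix.

Variables (k : fieldType) (n a1 a2 : nat).
Implicit Type M : rep k n a1 a2.

Notation vstd p q p' q' :=
  (vmap k (p + \sum_(j < n) q) q (p' + \sum_(j < n) q') q').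

Definition std_map (p q p' q' : nat) M (f : vstd p q p' q')
    (v : 'rV[k]_(a1 * p + a2 * q)) : 'rV[k]_(a1 * p' + a2 * q') :=
  vmap_row (std_components (vcomp (std_hom M (row_vmap v)) f)).

Lemma std_map_is_linear (p q p' q' : nat) M (f : vstd p q p' q') :
  linear (std_map M f).
Proof.
move=> c u v; rewrite /std_map.
have -> : std_hom M (row_vmap (c *: u + v))
    = c *: std_hom M (row_vmap u) + std_hom M (row_vmap v).
  congr pair; last by rewrite /= !(linearD, linearZ).
  rewrite /= scale_row_mx add_row_mx !(linearD, linearZ) /=; congr row_mx.
  apply/matrixP => i j; rewrite !mxE big_distrr -big_split /=.
  by apply: eq_bigr => l _; rewrite !mxE mulrDr mulrCA.
move: (std_hom _ _) (std_hom _ _) => X Y.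
rewrite /vmap_row /std_components /= !mulmxDl -!scalemxAl.
rewrite !(linearD, linearZ) /=.
by rewrite -add_row_mx -scale_row_mx.
Qed.

HB.instance Definition _ p q p' q' M (f : vstd p q p' q') :=
  GRing.isLinear.Build k _ _ _ (std_map M f) (std_map_is_linear M f).

Definition std_mx (p q p' q' : nat) M (f : vstd p q p' q') :=
  lin1_mx (std_map M f).

Lemma mul_std_mx (p q p' q' : nat) M (f : vstd p q p' q') v :
  v *m std_mx M f = std_map M f v.
Proof. exact: mul_rV_lin1. Qed.

Lemma hom_mxE (c1 c2 d1 d2 p q p' q' : nat) M
    (t0 : vmap k (p + \sum_(j < n) q) q c1 c2) (pi : vmap k c1 c2 d1 d2)
    (t1 : vmap k d1 d2 (p' + \sum_(j < n) q') q') :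
  hom_mx M t0 pi t1 = std_mx M (vcomp (vcomp t0 pi) t1).
Proof.
apply/matrixP => i j; rewrite !mxE /std_map !vcompA.
by [].
Qed.

(** The product of matrices passes through the components of the intermediate map, which determine
    that map because it is a morphism; hence the hypothesis on [f]. *)
Lemma std_mx_comp (p q p' q' p'' q'' : nat) M
    (f : vstd p q p' q') (g : vstd p' q' p'' q'') :
  is_hom (std_inj k n p q) (std_inj k n p' q') f ->
  std_mx M (vcomp f g) = std_mx M f *m std_mx M g.
Proof.
move=> fI; apply: mulmx_rV_inj => v; rewrite mulmxA !mul_std_mx /std_map.
rewrite vmap_rowK std_componentsK ?vcompA //.
exact: is_hom_comp (std_hom_is_hom _ _) fI.
Qed.

Lemma std_mx_id (p q : nat) M : std_mx M (vid k _ _ : vstd p q p q) = 1%:M.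
Proof.
apply: mulmx_rV_inj => v.
by rewrite mul_std_mx mulmx1 /std_map vcomp1r std_homK row_vmapK.
Qed.

Lemma std_mxB (p q p' q' : nat) M (f g : vstd p q p' q') :
  std_mx M (f - g) = std_mx M f - std_mx M g.
Proof.
apply: mulmx_rV_inj => v; rewrite mulmxBr !mul_std_mx /std_map vcompBr.
rewrite /vmap_row /std_components /= opp_row_mx add_row_mx.
by rewrite !linearB.
Qed.

(** The arrows of [M] enter [std_hom] only through the products [M j *m A.2], so a zero second
    component makes the image independent of [M]. *)
Lemma std_map_l (p q p' q' : nat) M (f : vstd p q p' q') v :
  std_map M f (row_mx v 0) =
    row_mx (mxvec (lsubmx (row_mx (vec_mx v) 0 *m f.1))) 0.
Proof.
rewrite /std_map /std_hom /row_vmap /vcomp /std_components /vmap_row /=.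
rewrite row_mxKl row_mxKr linear0 mul0mx linear0.
congr (row_mx (mxvec (lsubmx (row_mx _ _ *m _))) _).
by apply/matrixP => i j; rewrite !mxE big1 // => l _; rewrite mxE mulr0.
Qed.

Lemma std_map_r (p q p' q' : nat) M (f : vstd p q p' q') v :
  rsubmx (std_map M f (row_mx 0 v)) = mxvec (vec_mx v *m f.2).
Proof. by rewrite /std_map /vmap_row /= !row_mxKr. Qed.

(* Only the block Hom(M(2), _) -> Hom(M(1), _) depends on [M]. *)
Lemma std_mx_block (p q p' q' : nat) (f : vstd p q p' q') :
  exists A B, forall M, exists K, std_mx M f = block_mx A 0 K B.
Proof.
exists (ulsubmx (std_mx 0 f)), (drsubmx (std_mx 0 f)) => M.
exists (dlsubmx (std_mx M f)); rewrite -[LHS]submxK.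
have up M' v : row_mx (v *m ulsubmx (std_mx M' f)) (v *m ursubmx (std_mx M' f))
    = row_mx (mxvec (lsubmx (row_mx (vec_mx v) 0 *m f.1))) 0.
  rewrite -(std_map_l M') -mul_std_mx -{3}[std_mx M' f]submxK mul_row_block.
  by rewrite !mul0mx !addr0.
have dn M' v : v *m drsubmx (std_mx M' f) = mxvec (vec_mx v *m f.2).
  rewrite -(std_map_r M') -mul_std_mx -{2}[std_mx M' f]submxK mul_row_block.
  by rewrite row_mxKr mul0mx add0r.
congr block_mx; apply: mulmx_rV_inj => v.
- by have /eq_row_mx[-> _] := up M v; have /eq_row_mx[-> _] := up 0 v.
- by have /eq_row_mx[_ ->] := up M v; rewrite mulmx0.
- by rewrite !dn.
Qed.

End HomMatrix.

(* Conjugating by diag(1, 'X) on both summands multiplies the blocks [K] by 'X,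
   so the determinant is constant along the line through [K] and 0. *)
Lemma det_block_lower (k : fieldType) (m1 m2 n1 n2 : nat)
    (A1 : 'M[k]_m1) (B1 : 'M[k]_m2) (K1 : 'M[k]_(m2, m1))
    (A2 : 'M[k]_(m1, n1)) (B2 : 'M[k]_(m2, n2)) (K2 : 'M[k]_(m2, n1))
    (A3 : 'M[k]_(n1, m1)) (B3 : 'M[k]_(n2, m2)) (K3 : 'M[k]_(n2, m1))
    (A4 : 'M[k]_n1) (B4 : 'M[k]_n2) (K4 : 'M[k]_(n2, n1)) :
  \det (block_mx (block_mx A1 0 K1 B1) (block_mx A2 0 K2 B2)
                 (block_mx A3 0 K3 B3) (block_mx A4 0 K4 B4)) =
  \det (block_mx (block_mx A1 0 0 B1) (block_mx A2 0 0 B2)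
                 (block_mx A3 0 0 B3) (block_mx A4 0 0 B4)).
Proof.
pose D K1 K2 K3 K4 :=
  block_mx (block_mx A1 0 K1 B1) (block_mx A2 0 K2 B2)
           (block_mx A3 0 K3 B3) (block_mx A4 0 K4 B4).
pose P m n (A : 'M[k]_(m, n)) := map_mx polyC A.
pose DX := block_mx
  (block_mx (P _ _ A1) 0 ('X *: P _ _ K1) (P _ _ B1))
  (block_mx (P _ _ A2) 0 ('X *: P _ _ K2) (P _ _ B2))
  (block_mx (P _ _ A3) 0 ('X *: P _ _ K3) (P _ _ B3))
  (block_mx (P _ _ A4) 0 ('X *: P _ _ K4) (P _ _ B4)).
pose T m n : 'M[{poly k}]_(m + n) := block_mx 1%:M 0 0 'X%:M.
pose TT := block_mx (T m1 m2) 0 0 (T n1 n2).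
have DXE : \det (P _ _ (D K1 K2 K3 K4)) = \det DX.
  have TDX : TT *m P _ _ (D K1 K2 K3 K4) = DX *m TT.
    rewrite /P /D !map_block_mx /TT /DX /T !mulmx_block.
    rewrite ?mul0mx ?mulmx0 ?addr0 ?add0r ?map_mx0.
    rewrite !mul1mx !mulmx1.
    by rewrite !mul_scalar_mx !mul_mx_scalar.
  have detT : \det TT != 0.
    rewrite det_ublock !det_ublock !det1 !mul1r !det_scalar.
    by rewrite mulf_neq0 // expf_neq0 // polyX_eq0.
  by apply: (mulfI detT); rewrite -!det_mulmx TDX !det_mulmx mulrC.
(* Evaluation at 0 gives back the constant matrix [D] on one side and erases the blocks [K] of [DX]
   on the other. *)
have := congr1 (horner_eval 0) DXE.
rewrite -!det_map_mx.
have PK m n (A : 'M[k]_(m, n)) : map_mx (horner_eval 0) (P _ _ A) = A.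
  by apply/matrixP => i j; rewrite !mxE /horner_eval hornerC.
have XPK m n (A : 'M[k]_(m, n)) : map_mx (horner_eval 0) ('X *: P _ _ A) = 0.
  by apply/matrixP => i j; rewrite !mxE /horner_eval hornerM hornerX mul0r.
by rewrite PK /DX !map_block_mx !PK !XPK !map_mx0.
Qed.

(* The block matrix is theta of the header. *)
Lemma det_comparison (k : fieldType) (m n : nat) (e : n = m)
    (D D' : 'M[k]_(m, n)) (F0 : 'M_m) (F1 G1 : 'M_n) (S : 'M_(n, m)) :
  D *m F1 = F0 *m D' -> 1%:M - G1 *m F1 = S *m D' ->
  \det (castmx (erefl, e) D) =
    \det (block_mx F0 D S (- G1))
    * \det (block_mx 0 1%:M 1%:M 0 : 'M[k]_(n + n))
    * \det (castmx (erefl, e) D').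
Proof.
subst m; rewrite !castmx_id => DF /(canRL (subrK _)) SD.
(* Multiplying theta by diag(D', 1) turns its first block column into D F1 over 1 - G1 F1;
   subtracting the second block column times F1 leaves 0 over 1. *)
have := erefl (\det (block_mx F0 D S (- G1) *m block_mx D' 0 0 1%:M)).
rewrite [in RHS]mulmx_block !mulmx0 !mulmx1 !addr0 !add0r -DF.
rewrite det_mulmx det_ublock det1 mulr1.
have -> : block_mx (D *m F1) D (S *m D') (- G1)
  = block_mx 0 D 1%:M (- G1) *m block_mx 1%:M 0 F1 1%:M.
  rewrite mulmx_block !mulmx1 !mulmx0 !add0r; congr block_mx.
  by rewrite SD mulNmx addrK.
rewrite det_mulmx det_lblock !det1 !mulr1.
rewrite mulrAC => ->.
(* Swapping the block columns gives a lower triangular matrix with diagonal blocks [D] and 1. *)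
rewrite -det_mulmx mulmx_block !mulmx0 !mulmx1 !add0r !addr0.
by rewrite det_lblock det1 mulr1.
Qed.

(** * Independence of the resolution up to a nonzero constant *)

Section Proportional.

Variables (k : fieldType) (n a1 a2 b1 b2 p0 q0 p1 q1 : nat).
Variable (N : rep k n b1 b2).
Hypothesis e : (a1 * p1 + a2 * q1 = a1 * p0 + a2 * q0)%N.

Definition std_det (M : rep k n a1 a2) pi : k :=
  \det (castmx (erefl, e)
    (std_mx (p := p0) (q := q0) (p' := p1) (q' := q1) M pi)).

Lemma std_det_multiple iota pi iota' pi' :
  is_injective_resolution N (std_inj k n p0 q0) (std_inj k n p1 q1) iota pi ->
  is_injective_resolution N (std_inj k n p0 q0) (std_inj k n p1 q1) iota' pi' ->
  exists mu, forall M, std_det M pi = mu * std_det M pi'.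
Proof.
move=> res res'.
have [phi0 [phi1 [psi1 [s [[h0 h1 h1' hs] comm homot]]]]] :=
  comparison_homotopy res res'.
have [_ [_ piI] _] := res; have [_ [_ pi'I] _] := res'.
have [A1 [B1 E1]] := std_mx_block a1 a2 phi0.
have [A2 [B2 E2]] := std_mx_block a1 a2 pi.
have [A3 [B3 E3]] := std_mx_block a1 a2 s.
have [A4 [B4 E4]] := std_mx_block a1 a2 psi1.
(* The determinant of theta with its [M]-dependent blocks set to 0, times the sign of the block
   swap. *)
exists (\det (block_mx (block_mx A1 0 0 B1) (block_mx A2 0 0 B2)
                (block_mx A3 0 0 B3) (block_mx (- A4) 0 0 (- B4)))
  * \det (block_mx 0 1%:M 1%:M 0 :
            'M[k]_((a1 * p1 + a2 * q1) + (a1 * p1 + a2 * q1)))) => M.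
have DF := congr1 (std_mx M) comm; have GS := congr1 (std_mx M) homot.
move: DF GS; rewrite std_mxB !std_mx_comp // std_mx_id => DF GS.
rewrite /std_det (det_comparison e DF GS).
have [K1 ->] := E1 M; have [K2 ->] := E2 M.
have [K3 ->] := E3 M; have [K4 ->] := E4 M.
by rewrite opp_block_mx oppr0 det_block_lower.
Qed.

(** Each determinant is a multiple of the other. If one factor is 0, both determinants vanish
    identically and the factor 1 serves. *)
Lemma std_det_proportional iota pi iota' pi' :
  is_injective_resolution N (std_inj k n p0 q0) (std_inj k n p1 q1) iota pi ->
  is_injective_resolution N (std_inj k n p0 q0) (std_inj k n p1 q1) iota' pi' ->
  exists2 mu, mu != 0 & forall M, std_det M pi = mu * std_det M pi'.
Proof.
move=> res res'.
have [mu muE] := std_det_multiple res res'.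
have [nu nuE] := std_det_multiple res' res.
have [mu0|mu0] := eqVneq mu 0; last by exists mu.
exists 1; first exact: oner_neq0.
by move=> M; rewrite nuE muE mu0 mul0r !mulr0.
Qed.

End Proportional.

(** * Twists and base change *)

Section Transport.

Variables (k : fieldType) (n : nat).

Lemma is_isom_sym (c1 c2 d1 d2 : nat) (I : rep k n c1 c2)
    (J : rep k n d1 d2) t t' :
  is_isom I J t t' -> is_isom J I t' t.
Proof. by case. Qed.

Lemma injective_rep_isom (c1 c2 d1 d2 : nat) (I : rep k n c1 c2)
    (J : rep k n d1 d2) t t' :
  is_isom I J t t' -> is_injective_rep I -> is_injective_rep J.
Proof.
move=> [tI t'J _ t't] Iinj x1 x2 y1 y2 X Y i f iXY iinj fJ.
have [g [gI ig]] := Iinj _ _ _ _ _ _ _ _ iXY iinj (is_hom_comp fJ t'J).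
exists (vcomp g t); split; first exact: is_hom_comp gI tI.
by rewrite vcompA ig -vcompA t't vcomp1r.
Qed.

Lemma kermx_transport (b c c' d d' : nat) (A : 'M[k]_(b, c)) (B : 'M[k]_(c, d))
    (U : 'M_(c, c')) (U' : 'M_(c', c)) (V : 'M_(d, d')) (V' : 'M_(d', d)) :
  U *m U' = 1%:M -> U' *m U = 1%:M -> V *m V' = 1%:M ->
  (A :=: kermx B)%MS -> (A *m U :=: kermx (U' *m B *m V))%MS.
Proof.
move=> UU' U'U VV' AB; apply/eqmxP/andP; split.
  apply/sub_kermxP; rewrite !mulmxA -(mulmxA A) UU' mulmx1.
  have /sub_kermxP -> : (A <= kermx B)%MS by rewrite AB.
  by rewrite mul0mx.
apply/rV_subP => u /sub_kermxP; rewrite !mulmxA => /(congr1 (mulmx^~ V')).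
rewrite mul0mx -mulmxA VV' mulmx1 => /sub_kermxP; rewrite -AB => uA.
by rewrite -[u]mulmx1 -U'U mulmxA; apply: submxMr.
Qed.

Lemma resolution_transport (b1 b2 c1 c2 d1 d2 c1' c2' d1' d2' : nat)
    (N : rep k n b1 b2) (I0 : rep k n c1 c2) (I1 : rep k n d1 d2)
    (J0 : rep k n c1' c2') (J1 : rep k n d1' d2') iota pi t0 t0' t1 t1' :
  is_isom I0 J0 t0 t0' -> is_isom I1 J1 t1 t1' ->
  is_injective_resolution N I0 I1 iota pi ->
  is_injective_resolution N J0 J1 (vcomp iota t0) (vcomp (vcomp t0' pi) t1).
Proof.
move=> iso0 iso1 [[I0i I1i] [iotaI piI] [[inj1 inj2] [ex1 ex2] [sur1 sur2]]].
have [t0I t0'J [tt'1 tt'2] [t't1 t't2]] := iso0.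
have [t1I t1'J [uu'1 uu'2] [u'u1 u'u2]] := iso1.
have freeM (b c c' : nat) (A : 'M[k]_(b, c)) (U : 'M_(c, c'))
    (U' : 'M_(c', c)) :
    U *m U' = 1%:M -> row_free A -> row_free (A *m U).
  move=> UU' /row_freeP[B AB]; apply/row_freeP; exists (U' *m B).
  by rewrite mulmxA -(mulmxA A) UU' mulmx1.
have fullM (c c' d d' : nat) (B : 'M[k]_(c, d)) (U : 'M_(c, c'))
    (U' : 'M_(c', c)) (V : 'M_(d, d')) (V' : 'M_(d', d)) :
    U *m U' = 1%:M -> V' *m V = 1%:M -> row_full B -> row_full (U' *m B *m V).
  move=> UU' VV' /row_fullP[C CB]; apply/row_fullP; exists (V' *m C *m U).
  by rewrite !mulmxA -(mulmxA (V' *m C)) UU' mulmx1 -(mulmxA V') CB mulmx1.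
split.
- split; first exact: injective_rep_isom iso0 I0i.
  exact: injective_rep_isom iso1 I1i.
- split; first exact: is_hom_comp iotaI t0I.
  exact: is_hom_comp (is_hom_comp t0'J piI) t1I.
- split; split=> /=.
  + exact: freeM tt'1 inj1.
  + exact: freeM tt'2 inj2.
  + exact: kermx_transport tt'1 t't1 uu'1 ex1.
  + exact: kermx_transport tt'2 t't2 uu'2 ex2.
  + exact: fullM tt'1 u'u1 sur1.
  + exact: fullM tt'2 u'u2 sur2.
Qed.

(** Proportionality compares resolutions of one and the same representation; this turns a resolution
    of [N] into one of an isomorphic [N'], keeping [pi]. *)
Lemma resolution_precomp (b1 b2 c1 c2 d1 d2 : nat)
    (N N' : rep k n b1 b2) (I0 : rep k n c1 c2) (I1 : rep k n d1 d2)
    iota pi sigma :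
  is_hom N' N sigma -> sigma.1 \in unitmx -> sigma.2 \in unitmx ->
  is_injective_resolution N I0 I1 iota pi ->
  is_injective_resolution N' I0 I1 (vcomp sigma iota) pi.
Proof.
move=> sN s1 s2 [inj [iotaI piI] [[inj1 inj2] [ex1 ex2] sur]].
split=> //; first by split=> //; exact: is_hom_comp sN iotaI.
split=> //; split=> /=.
- by rewrite /row_free mxrankMfree // -/(row_free _) row_free_unit.
- by rewrite /row_free mxrankMfree // -/(row_free _) row_free_unit.
- by apply: eqmx_trans ex1; apply: eqmxMfull; rewrite row_full_unit.
- by apply: eqmx_trans ex2; apply: eqmxMfull; rewrite row_full_unit.
Qed.

End Transport.

Section Twist.

Variables (k : fieldType) (n : nat).

(* The action of h^-1 in GL_n on representations, extended to all matrices. *)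
Definition twist (a1 a2 : nat) (h : 'M[k]_n) (M : rep k n a1 a2) :
    rep k n a1 a2 :=
  [ffun i => \sum_(j < n) h j i *: M j].

Lemma twist1 (a1 a2 : nat) (M : rep k n a1 a2) : twist 1%:M M = M.
Proof.
apply/ffunP => i; rewrite ffunE (bigD1 i) //= mxE eqxx scale1r big1 ?addr0 //.
by move=> j /negPf ji; rewrite mxE ji scale0r.
Qed.

Lemma twistM (a1 a2 : nat) h h' (M : rep k n a1 a2) :
  twist h (twist h' M) = twist (h' *m h) M.
Proof.
apply/ffunP => i; rewrite !ffunE.
under eq_bigr => j _ do rewrite ffunE scaler_sumr.
rewrite exchange_big; apply: eq_bigr => l _; rewrite mxE scaler_suml.
by apply: eq_bigr => j _; rewrite scalerA mulrC.
Qed.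

Lemma is_hom_twist (a1 a2 b1 b2 : nat) (M : rep k n a1 a2) (N : rep k n b1 b2)
    h f : is_hom M N f -> is_hom (twist h M) (twist h N) f.
Proof.
move=> fMN i; rewrite !ffunE mulmx_suml mulmx_sumr.
by apply: eq_bigr => j _; rewrite -scalemxAl fMN scalemxAr.
Qed.

(** The isomorphism from the [h]-twist of E_1^p + E_2^q back to it: [h] acts on the factor k^n of
    E_2(1), and everything else is fixed. *)
Definition std_twist (p q : nat) (h : 'M[k]_n) :
    vmap k (p + \sum_(j < n) q) q (p + \sum_(j < n) q) q :=
  (block_mx 1%:M 0 0 (\mxblock_(j < n, i < n) ((h j i)%:M : 'M[k]_q)), 1%:M).

(** Retwisting the target compensates for twisting [M], with the same components. Applied to the
    identity of a standard injective, it exhibits [std_twist] itself as a [std_hom]. *)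
Lemma std_hom_twist (a1 a2 p q : nat) h (M : rep k n a1 a2)
    (A : vmap k a1 a2 p q) :
  vcomp (std_hom M A) (std_twist p q h) = std_hom (twist h M) A.
Proof.
congr pair; rewrite /= ?mulmx1 // mul_row_block !mulmx0 mulmx1 addr0 add0r.
rewrite mul_mxrow_mxblock; congr row_mx; apply: eq_mxrow => i.
rewrite ffunE mulmx_suml; apply: eq_bigr => j _.
by rewrite mul_mx_scalar scalemxAl.
Qed.

Lemma std_twistM (p q : nat) h h' :
  vcomp (std_twist p q h) (std_twist p q h') = std_twist p q (h *m h').
Proof.
congr pair; rewrite /= ?mulmx1 // mulmx_block !mulmx0 !mul0mx mulmx1.
rewrite !addr0 add0r.
congr block_mx; rewrite mul_mxblock; apply: eq_mxblock => i j.
rewrite mxE raddf_sum; apply: eq_bigr => l _.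
by rewrite -scalar_mxM.
Qed.

Lemma std_twist1 (p q : nat) : std_twist p q 1%:M = vid k _ _.
Proof.
have stdE := std_componentsK (@is_hom_id _ _ _ _ (std_inj k n p q)).
by rewrite -[LHS]vcomp1l -stdE std_hom_twist twist1.
Qed.

Lemma std_twist_isom (p q : nat) h : h \in unitmx ->
  is_isom (twist h (std_inj k n p q)) (std_inj k n p q)
    (std_twist p q h) (std_twist p q (invmx h)).
Proof.
move=> hU; have tauI h' :
    is_hom (twist h' (std_inj k n p q)) (std_inj k n p q) (std_twist p q h').
  rewrite -[X in is_hom _ _ X]vcomp1l.
  rewrite -(std_componentsK (@is_hom_id _ _ _ _ (std_inj k n p q))).
  by rewrite std_hom_twist; apply: std_hom_is_hom.
split=> //.
- have := is_hom_twist h (tauI (invmx h)).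
  by rewrite twistM mulVmx // twist1.
- by rewrite std_twistM mulmxV // std_twist1.
- by rewrite std_twistM mulVmx // std_twist1.
Qed.

(** The last factor changes only coordinates that [std_components] discards, so [h'] is arbitrary;
    taking it inverse to [h] matches [resolution_twist]. *)
Lemma std_mx_twist (a1 a2 p q p' q' : nat) h h' (M : rep k n a1 a2) pi :
  std_mx (p := p) (q := q) (p' := p') (q' := q') (twist h M) pi =
  std_mx M (vcomp (vcomp (std_twist p q h) pi) (std_twist p' q' h')).
Proof.
apply: mulmx_rV_inj => v; rewrite !mul_std_mx /std_map.
rewrite !vcompA std_hom_twist; move: (vcomp _ pi) => X.
rewrite /vmap_row /std_components /= mulmx1 -{2}[X.1]hsubmxK mul_row_block.
by rewrite row_mxKl mulmx1 mulmx0 addr0.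
Qed.

(** The whole resolution is twisted by the inverse of [h] and its terms are made standard again by
    [std_twist]. Exactness concerns only the linear maps at the vertices, which twisting leaves
    alone. *)
Lemma resolution_twist (b1 b2 p0 q0 p1 q1 : nat) (N : rep k n b1 b2) h iota pi :
  h \in unitmx ->
  is_injective_resolution N (std_inj k n p0 q0) (std_inj k n p1 q1) iota pi ->
  is_injective_resolution (twist (invmx h) N)
    (std_inj k n p0 q0) (std_inj k n p1 q1)
    (vcomp iota (std_twist p0 q0 (invmx h)))
    (vcomp (vcomp (std_twist p0 q0 h) pi) (std_twist p1 q1 (invmx h))).
Proof.
move=> hU [_ [iotaI piI] ex].
have iso p q := @std_twist_isom p q (invmx h) (etrans (unitmx_inv h) hU).
rewrite invmxK in iso.
apply: (resolution_transport (iso _ _) (iso _ _)); split=> //.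
- by split; apply: injective_rep_isom (is_isom_sym (iso _ _)) _;
    apply: std_inj_injective.
- by split; apply: is_hom_twist.
Qed.

Definition base_mx (a1 a2 p q : nat) (u : 'M[k]_a1) (v : 'M[k]_a2) :
    'M[k]_(a1 * p + a2 * q) :=
  block_mx (lin_mulmx u) 0 0 (lin_mulmx v).

Lemma base_mxE (a1 a2 p q : nat) u v (A : vmap k a1 a2 p q) :
  vmap_row A *m base_mx p q u v = vmap_row (u *m A.1, v *m A.2).
Proof.
by rewrite mul_row_block !mulmx0 addr0 add0r !mul_vec_lin.
Qed.

Lemma base_mx_unit (a1 a2 p q : nat) (u : 'M[k]_a1) (v : 'M[k]_a2) :
  u \in unitmx -> v \in unitmx -> base_mx p q u v \in unitmx.
Proof.
move=> uU vU; have /mulmx1_unit[] // :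
    base_mx p q u v *m base_mx p q (invmx u) (invmx v) = 1%:M.
  apply: mulmx_rV_inj => w; rewrite mulmxA mulmx1 -[w]row_vmapK !base_mxE /=.
  by rewrite !mulmxA !mulVmx // !mul1mx.
Qed.

(** The pair (u^-1, v) is an isomorphism from [M] to [M']; the outer factors are precomposition with
    it and with its inverse. *)
Lemma std_mx_base_change (a1 a2 p q p' q' : nat) (M M' : rep k n a1 a2) u v pi :
  u \in unitmx -> v \in unitmx -> (forall i, M' i = u *m M i *m v) ->
  std_mx (p := p) (q := q) (p' := p') (q' := q') M' pi =
  base_mx p q (invmx u) v *m std_mx M pi *m base_mx p' q' u (invmx v).
Proof.
move=> uU vU M'E; apply: mulmx_rV_inj => w; rewrite !mulmxA.
rewrite -[w]row_vmapK base_mxE !mul_std_mx base_mxE; congr vmap_row.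
rewrite !vmap_rowK; move: (row_vmap w) => [A1 A2] /=.
rewrite /std_components /std_hom /vcomp /=; congr pair.
  rewrite -!mulmx_lsub mulmxA; congr (_ *m _).
  rewrite mul_mx_row mulmxA mulmxV // mul1mx mul_mxrow; congr row_mx.
  by apply: eq_mxrow => j; rewrite M'E !mulmxA.
by rewrite !mulmxA mulVmx // mul1mx.
Qed.

Lemma det_castmxM (m m' : nat) (e : m' = m) (A : 'M[k]_m) (D : 'M_(m, m'))
    (B : 'M_m') :
  \det (castmx (erefl, e) (A *m D *m B)) =
  \det A * \det B * \det (castmx (erefl, e) D).
Proof. by subst m; rewrite !castmx_id !det_mulmx mulrAC. Qed.

End Twist.

Lemma rep_act_invE (k : fieldType) (n a1 a2 : nat) g (M : rep k n a1 a2) i :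
  rep_act (gl_inv g) M i = invmx g.1.1 *m twist g.2 M i *m g.1.2.
Proof. by rewrite !ffunE /= !invmxK. Qed.

(** The action is a twist followed by a base change. The base change contributes [C]. The twist
    conjugates [pi] into a resolution of a twist of [N], which [sigma] makes comparable with
    [pi]. *)
Lemma std_det_rep_act (k : fieldType) (n a1 a2 b1 b2 p0 q0 p1 q1 : nat)
    (N : rep k n b1 b2) (e : (a1 * p1 + a2 * q1 = a1 * p0 + a2 * q0)%N)
    iota pi :
  is_injective_resolution N (std_inj k n p0 q0) (std_inj k n p1 q1) iota pi ->
  (forall h, h \in unitmx -> exists sigma,
    [/\ is_hom (twist h N) N sigma, sigma.1 \in unitmx & sigma.2 \in unitmx]) ->
  forall g, in_gl g -> exists2 mu, mu != 0 &
    forall M, std_det e (rep_act (gl_inv g) M) pi = mu * std_det e M pi.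
Proof.
move=> res isoN g /and3P[u v h].
have hV : invmx g.2 \in unitmx by rewrite unitmx_inv.
have [sigma [sN s1 s2]] := isoN _ hV.
have [mu mu0 muE] := std_det_proportional e
  (resolution_twist h res) (resolution_precomp sN s1 s2 res).
have uV : invmx g.1.1 \in unitmx by rewrite unitmx_inv.
set C := \det (base_mx p0 q0 (invmx (invmx g.1.1)) g.1.2) *
  \det (base_mx p1 q1 (invmx g.1.1) (invmx g.1.2)).
exists (C * mu).
  by rewrite !mulf_neq0 // -unitfE -unitmxE base_mx_unit // ?unitmx_inv.
move=> M; rewrite /std_det (std_mx_base_change pi uV v (rep_act_invE g M)).
rewrite det_castmxM.
rewrite -[RHS]mulrA; congr (_ * _).
by rewrite (std_mx_twist g.2 (invmx g.2)); apply: muE.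
Qed.

(** The isomorphisms that fix the bases also carry the chosen resolution to one by standard
    injectives. *)
Lemma schofield_std (k : fieldType) (n a1 a2 b1 b2 : nat) (N : rep k n b1 b2)
    (c : rep k n a1 a2 -> k) :
  is_schofield N c -> exists p0 q0 p1 q1 iota pi,
    is_injective_resolution N (std_inj k n p0 q0) (std_inj k n p1 q1) iota pi /\
    exists e, forall M, c M = std_det e M pi.
Proof.
move=> [c1 [c2 [d1 [d2 [I0 [I1 [iota [pi [res]]]]]]]]].
move=> [p0 [q0 [p1 [q1 [t0 [t0' [t1 [t1' [iso0 iso1 [e cE]]]]]]]]]].
exists p0, q0, p1, q1, (vcomp iota t0), (vcomp (vcomp t0' pi) t1); split.
  exact: resolution_transport iso0 iso1 res.
by exists e => M; rewrite cE hom_mxE.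
Qed.

(** * Polynomial and regular functions *)

(** The first clause replaces function extensionality. The notion lets polynomial and regular
    functions share their closure lemmas. *)
Definition fun_subalgebra (k : fieldType) (T : Type) (P : (T -> k) -> Prop) :=
  [/\ forall F G, F =1 G -> P F -> P G,
      forall c, P (fun=> c),
      forall F G, P F -> P G -> P (fun t => F t + G t)
    & forall F G, P F -> P G -> P (fun t => F t * G t)].

Section FunSubalgebra.

Variables (k : fieldType) (T : Type) (P : (T -> k) -> Prop).
Hypothesis Palg : fun_subalgebra P.

Lemma fsub_ext F G : F =1 G -> P F -> P G.
Proof. by case: Palg => + _ _ _; apply. Qed.

Lemma fsub_const c : P (fun=> c).
Proof. by case: Palg. Qed.

Lemma fsubD F G : P F -> P G -> P (fun t => F t + G t).
Proof. by case: Palg => _ _ + _; apply. Qed.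

Lemma fsubM F G : P F -> P G -> P (fun t => F t * G t).
Proof. by case: Palg => _ _ _; apply. Qed.

Lemma fsub_sum (J : Type) (r : seq J) (Q : pred J) (F : J -> T -> k) :
  (forall j, P (F j)) -> P (fun t => \sum_(j <- r | Q j) F j t).
Proof.
move=> PF; elim: r => [|j r IHr].
  by apply: fsub_ext (fsub_const 0) => t; rewrite big_nil.
have [Qj|Qj] := boolP (Q j).
  by apply: fsub_ext (fsubD (PF j) IHr) => t; rewrite big_cons Qj.
by apply: fsub_ext IHr => t; rewrite big_cons (negPf Qj).
Qed.

Lemma fsub_prod (J : Type) (r : seq J) (Q : pred J) (F : J -> T -> k) :
  (forall j, P (F j)) -> P (fun t => \prod_(j <- r | Q j) F j t).
Proof.
move=> PF; elim: r => [|j r IHr].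
  by apply: fsub_ext (fsub_const 1) => t; rewrite big_nil.
have [Qj|Qj] := boolP (Q j).
  by apply: fsub_ext (fsubM (PF j) IHr) => t; rewrite big_cons Qj.
by apply: fsub_ext IHr => t; rewrite big_cons (negPf Qj).
Qed.

Lemma fsubX F m : P F -> P (fun t => F t ^+ m).
Proof.
move=> PF; elim: m => [|m IHm]; first exact: fsub_const.
by apply: fsub_ext (fsubM PF IHm) => t; rewrite exprS.
Qed.

Lemma fsub_mulmx (m n p : nat) (A : T -> 'M[k]_(m, n)) (B : T -> 'M[k]_(n, p)) :
  (forall i j, P (fun t => A t i j)) -> (forall i j, P (fun t => B t i j)) ->
  forall i j, P (fun t => (A t *m B t) i j).
Proof.
move=> PA PB i j; apply: (@fsub_ext (fun t => \sum_l A t i l * B t l j)).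
  by move=> t; rewrite mxE.
by apply: fsub_sum => l; apply: fsubM.
Qed.

Lemma fsub_det (m : nat) (A : T -> 'M[k]_m) :
  (forall i j, P (fun t => A t i j)) -> P (fun t => \det (A t)).
Proof.
move=> PA; apply: fsub_sum => s; apply: fsubM; first exact: fsub_const.
exact: fsub_prod.
Qed.

Lemma fsub_adj (m : nat) (A : T -> 'M[k]_m) :
  (forall i j, P (fun t => A t i j)) ->
  forall i j, P (fun t => (\adj (A t)) i j).
Proof.
move=> PA i j.
apply: (@fsub_ext (fun t => (-1) ^+ (j + i) * \det (row' j (col' i (A t))))).
  by move=> t; rewrite mxE.
apply: fsubM; first exact: fsub_const.
by apply: fsub_det => i' j'; apply: fsub_ext (PA _ _) => t; rewrite !mxE.
Qed.

Lemma fsub_peval (I : finType) (p : {mpoly k[#|I|]}) (y : T -> I -> k) :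
  (forall i, P (y^~ i)) -> P (fun t => peval p (y t)).
Proof.
move=> Py; apply: (@fsub_ext (fun t => \sum_(m <- msupp p)
    p@_m * \prod_j y t (enum_val j) ^+ m j)).
  by move=> t; rewrite /peval mevalE.
apply: fsub_sum => m; apply: fsubM; first exact: fsub_const.
by apply: fsub_prod => j; apply: fsubX.
Qed.

End FunSubalgebra.

Definition poly_fun (k : fieldType) (T : Type) (I : finType) (x : T -> I -> k)
    (F : T -> k) : Prop :=
  exists p, forall t, F t = peval p (x t).

Lemma poly_fun_subalgebra (k : fieldType) (T : Type) (I : finType)
    (x : T -> I -> k) : fun_subalgebra (poly_fun x).
Proof.
split.
- by move=> F G FG [p pE]; exists p => t; rewrite -FG.
- by move=> c; exists c%:MP => t; rewrite /peval mevalC.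
- move=> F G [p pE] [q qE]; exists (p + q) => t.
  by rewrite pE qE /peval mevalD.
- move=> F G [p pE] [q qE]; exists (p * q) => t.
  by rewrite pE qE /peval mevalM.
Qed.

Lemma poly_fun_coord (k : fieldType) (T : Type) (I : finType)
    (x : T -> I -> k) i : poly_fun x (x^~ i).
Proof.
by exists 'X_(enum_rank i) => t; rewrite /peval mevalXU enum_rankK.
Qed.

Section RegularFunctions.

Variables (k : fieldType) (a1 a2 n : nat).
Notation glT := (glt k a1 a2 n).

Definition gl_det (g : glT) : k := \det g.1.1 * \det g.1.2 * \det g.2.

Lemma gl_det_neq0 g : in_gl g -> gl_det g != 0.
Proof. by case/and3P => u v h; rewrite !mulf_neq0 // -unitfE. Qed.

(** This is the regularity clause of [is_character]. *)
Definition regular_fun (F : glT -> k) : Prop :=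
  exists p m, forall g, in_gl g -> F g = peval p (glt_coord g) / gl_det g ^+ m.

Notation gl_poly := (poly_fun (@glt_coord k a1 a2 n)).

Let gl_poly_alg : fun_subalgebra gl_poly := poly_fun_subalgebra _.

Lemma poly_regular F : gl_poly F -> regular_fun F.
Proof. by case=> p pE; exists p, 0 => g _; rewrite pE expr0 divr1. Qed.

Lemma poly_gl_entries :
  [/\ forall i j, gl_poly (fun g => g.1.1 i j),
      forall i j, gl_poly (fun g => g.1.2 i j)
    & forall i j, gl_poly (fun g => g.2 i j)].
Proof.
split=> i j.
- exact: (poly_fun_coord (@glt_coord k a1 a2 n) (inl (inl (i, j)))).
- exact: (poly_fun_coord (@glt_coord k a1 a2 n) (inl (inr (i, j)))).
- exact: (poly_fun_coord (@glt_coord k a1 a2 n) (inr (i, j))).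
Qed.

Lemma poly_gl_det : gl_poly gl_det.
Proof.
have [P1 P2 P3] := poly_gl_entries; have Palg := gl_poly_alg.
by apply: (fsubM Palg); [apply: (fsubM Palg)|]; apply: fsub_det.
Qed.

Lemma regular_fun_subalgebra : fun_subalgebra regular_fun.
Proof.
have [d dE] := poly_gl_det; split.
- by move=> F G FG [p [m pE]]; exists p, m => g gU; rewrite -FG pE.
- by move=> c; exists c%:MP, 0 => g _; rewrite /peval mevalC expr0 divr1.
- move=> F G [p [m pE]] [q [l qE]].
  exists (p * d ^+ l + q * d ^+ m), (m + l)%N => g gU.
  rewrite pE // qE // /peval mevalD !mevalM !rmorphXn /= -!/(peval d _) -dE.
  have := gl_det_neq0 gU; move: (gl_det g) => D D0.
  by rewrite addf_div ?expf_neq0 // exprD.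
- move=> F G [p [m pE]] [q [l qE]]; exists (p * q), (m + l)%N => g gU.
  by rewrite pE // qE // /peval mevalM exprD mulf_div.
Qed.

Lemma regular_inv i j : regular_fun (fun g => invmx g.1.1 i j).
Proof.
have [P1 P2 P3] := poly_gl_entries; have Palg := gl_poly_alg.
(* Cramer's rule; the two extra determinants make the denominator the full [gl_det]. *)
have [p pE] : gl_poly
    (fun g => \det g.1.2 * \det g.2 * (\adj g.1.1) i j).
  apply: (fsubM Palg); last exact: (fsub_adj Palg).
  by apply: (fsubM Palg); apply: (fsub_det Palg).
exists p, 1 => g gU; rewrite -pE expr1; have := gl_det_neq0 gU.
rewrite /gl_det !mulf_eq0 !negb_or => /andP[/andP[d1 d2] d3].
have [uU _ _] := and3P gU.
rewrite /invmx uU mxE; field.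
by rewrite d1 d2 d3.
Qed.

End RegularFunctions.

Lemma std_det_polynomial (k : fieldType) (n a1 a2 p0 q0 p1 q1 : nat)
    (e : (a1 * p1 + a2 * q1 = a1 * p0 + a2 * q0)%N) pi :
  is_polynomial_fun (fun M : rep k n a1 a2 => std_det (n := n) e M pi).
Proof.
pose P := poly_fun (@rep_coord k n a1 a2).
have Palg : fun_subalgebra P by exact: poly_fun_subalgebra.
have PM j r s : P (fun M => M j r s).
  exact: (poly_fun_coord (@rep_coord k n a1 a2) (j, r, s)).
have cst m l (A : 'M[k]_(m, l)) r s : P (fun=> A r s).
  exact: fsub_const.
suff stdP r s : P (fun M => std_mx M pi r s).
  apply: (fsub_det Palg) => r s; apply: (fsub_ext Palg _ (stdP _ _)) => M.
  by rewrite castmxE.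
(* Row [r] is the image of a basis vector, with components [A]. Its entries are affine in [M] in the
   first block and constant in the second. *)
pose A := row_vmap (delta_mx 0 r : 'rV[k]_(a1 * p0 + a2 * q0)).
apply: (@fsub_ext _ _ _ Palg (fun M =>
  vmap_row (std_components (vcomp (std_hom M A) pi)) 0 s)).
  by move=> M; rewrite [RHS]mxE.
rewrite /vmap_row /=; case: (split_ordP s) => {}s ->.
  case/mxvec_indexP: s => s1 s2.
  apply: (@fsub_ext _ _ _ Palg (fun M =>
      (row_mx A.1 (\mxrow_j (M j *m A.2)) *m pi.1) s1 (lshift _ s2))).
    by move=> M; rewrite row_mxEl mxvecE [RHS]mxE.
  apply: (fsub_mulmx Palg); last exact: cst.
  move=> i j; case: (split_ordP j) => {}j ->.
    by apply: (fsub_ext Palg _ (cst _ _ A.1 i j)) => M; rewrite row_mxEl.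
  apply: (@fsub_ext _ _ _ Palg (fun M =>
      (M (tagnat.sig1 j) *m A.2) i (tagnat.sig2 j))).
    by move=> M; rewrite row_mxEr [RHS]mxE.
  exact: (fsub_mulmx Palg).
apply: (fsub_ext Palg _ (cst _ _ (mxvec (A.2 *m pi.2)) 0 s)) => M.
by rewrite row_mxEr.
Qed.

Lemma regular_rep_act (k : fieldType) (n a1 a2 : nat) (M : rep k n a1 a2)
    (f : rep k n a1 a2 -> k) :
  is_polynomial_fun f -> regular_fun (fun g => f (rep_act (gl_inv g) M)).
Proof.
move=> [p pE]; have Ralg := regular_fun_subalgebra k a1 a2 n.
have [P1 P2 P3] := poly_gl_entries k a1 a2 n.
apply: (fsub_ext Ralg (fun g => esym (pE _))).
apply: (fsub_peval Ralg) => -[[i r] s].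
apply: (@fsub_ext _ _ _ Ralg
  (fun g => (invmx g.1.1 *m twist g.2 M i *m g.1.2) r s)).
  by move=> g; rewrite /rep_coord rep_act_invE.
apply: (fsub_mulmx Ralg) => [r' s'|r' s']; last exact: poly_regular.
apply: (fsub_mulmx Ralg) => [{}r' {}s'|{}r' {}s']; first exact: regular_inv.
apply: (@fsub_ext _ _ _ Ralg (fun g => \sum_j g.2 j i * M j r' s')).
  by move=> g; rewrite ffunE summxE; apply: eq_bigr => j _; rewrite mxE.
apply: (fsub_sum Ralg) => j; apply: (fsubM Ralg); last exact: fsub_const.
exact: poly_regular.
Qed.

Lemma invmxM (k : fieldType) (n : nat) (A B : 'M[k]_n) :
  A \in unitmx -> B \in unitmx -> invmx (A *m B) = invmx B *m invmx A.
Proof.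
move=> uA uB; have uAB : A *m B \in unitmx by rewrite unitmx_mul uA.
rewrite -[RHS](mulmxK uAB) -!mulmxA (mulmxA (invmx A)) mulVmx // mul1mx.
by rewrite !mulmxA mulVmx // mul1mx.
Qed.

Lemma rep_act_invM (k : fieldType) (n a1 a2 : nat) g h (M : rep k n a1 a2) :
  in_gl g -> in_gl h ->
  rep_act (gl_inv (gl_mul g h)) M = rep_act (gl_inv h) (rep_act (gl_inv g) M).
Proof.
move=> /and3P[ug _ _] /and3P[uh _ _]; apply/ffunP => i.
rewrite !rep_act_invE /= invmxM // -twistM -!mulmxA; congr (_ *m _).
rewrite !mulmxA; congr (_ *m _).
rewrite [in LHS]ffunE [in RHS]ffunE mulmx_sumr mulmx_suml.
by apply: eq_bigr => j _; rewrite rep_act_invE -scalemxAr -scalemxAl.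
Qed.

Lemma semi_invariant_of_scalars (k : fieldType) (n a1 a2 : nat)
    (f : rep k n a1 a2 -> k) :
  is_polynomial_fun f ->
  (forall g, in_gl g -> exists2 mu, mu != 0 &
    forall M, f (rep_act (gl_inv g) M) = mu * f M) ->
  semi_invariant f.
Proof.
move=> fP fS; split=> //.
(* Excluded middle separates the zero function, which gets the trivial character, from the case with
   a point [M0] to divide at. *)
have [[M0 /eqP fM0]|f0] := Classical_Prop.classic (exists M, f M <> 0);
  last first.
  exists (fun=> 1); split.
    split=> *; rewrite ?mulr1 //; first exact/eqP/oner_neq0.
    by exists 1, 0 => g _; rewrite /peval rmorph1 expr0 divr1.
  move=> g _ M; rewrite mul1r.
  have fE L : f L = 0.
    by have [//|/eqP fL] := eqVneq (f L) 0; case: f0; exists L.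
  by rewrite /fun_act !fE.
pose chi g := f (rep_act (gl_inv g) M0) / f M0.
have chiE g M : in_gl g -> f (rep_act (gl_inv g) M) = chi g * f M.
  by move=> /fS[mu _ muE]; rewrite /chi !muE mulfK.
exists chi; split=> [|g gU M]; last exact: chiE.
split.
- by move=> g /fS[mu mu0 muE]; apply/eqP; rewrite /chi muE mulfK.
(* The point (gh)^-1 M0 = h^-1 (g^-1 M0) allows [chiE] to be applied twice. *)
- move=> g h gU hU; rewrite {1}/chi rep_act_invM // !chiE //.
  by rewrite mulrA mulfK // mulrC.
- have Ralg := regular_fun_subalgebra k a1 a2 n.
  apply: (fsubM Ralg); first exact: regular_rep_act.
  exact: fsub_const.
Qed.

Lemma schofield_semi_invariant (k : fieldType) (n a1 a2 b1 b2 : nat)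
    (N : rep k n b1 b2) :
  (forall h, h \in unitmx -> exists sigma,
    [/\ is_hom (twist h N) N sigma, sigma.1 \in unitmx & sigma.2 \in unitmx]) ->
  forall c : rep k n a1 a2 -> k, is_schofield N c -> semi_invariant c.
Proof.
move=> isoN c /schofield_std[p0 [q0 [p1 [q1 [iota [pi [res [e cE]]]]]]]].
apply: semi_invariant_of_scalars.
  by have [p pE] := std_det_polynomial e pi; exists p => M; rewrite cE pE.
move=> g /(std_det_rep_act e res isoN)[mu mu0 muE].
by exists mu => // M; rewrite !cE.
Qed.

(** * The representations N1 and N2 *)

Lemma ord3P (P : 'I_3 -> Prop) : P 0 -> P 1 -> P 2%:R -> forall i, P i.
Proof.
move=> P0 P1 P2 [[|[|[|//]]] lt_i].
- by rewrite (_ : Ordinal _ = 0) //; apply: val_inj.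
- by rewrite (_ : Ordinal _ = 1) //; apply: val_inj.
- by rewrite (_ : Ordinal _ = 2%:R) //; apply: val_inj.
Qed.

Lemma sum_ord3 (V : zmodType) (F : 'I_3 -> V) :
  \sum_(i < 3) F i = F 0 + F 1 + F 2%:R.
Proof.
rewrite !big_ord_recr big_ord0 /= add0r.
by congr (_ + _ + _); congr F; apply: val_inj.
Qed.

Section Blocks.

Variables (k : fieldType) (b : nat).
Implicit Types X Y Z : 'M[k]_b.

Definition row6 X Y Z S T U : 'M[k]_(b, b + (b + (b + (b + (b + b))))) :=
  row_mx X (row_mx Y (row_mx Z (row_mx S (row_mx T U)))).

Lemma mul_row3_col3 c X Y Z (X' Y' Z' : 'M_(b, c)) :
  row3 X Y Z *m col3 X' Y' Z' = X *m X' + Y *m Y' + Z *m Z'.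
Proof. by rewrite /row3 /col3 !mul_row_col addrA. Qed.

Lemma mul_row6_col6 c X Y Z S T U (X' Y' Z' S' T' U' : 'M_(b, c)) :
  row6 X Y Z S T U *m col6 X' Y' Z' S' T' U' =
  X *m X' + Y *m Y' + Z *m Z' + S *m S' + T *m T' + U *m U'.
Proof. by rewrite /row6 /col6 !mul_row_col !addrA. Qed.

Lemma mul_col3 c d (X Y Z : 'M_(b, c)) (A : 'M[k]_(c, d)) :
  col3 X Y Z *m A = col3 (X *m A) (Y *m A) (Z *m A).
Proof. by rewrite /col3 !mul_col_mx. Qed.

Lemma mul_col6 c d (X Y Z S T U : 'M_(b, c)) (A : 'M[k]_(c, d)) :
  col6 X Y Z S T U *m A =
  col6 (X *m A) (Y *m A) (Z *m A) (S *m A) (T *m A) (U *m A).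
Proof. by rewrite /col6 !mul_col_mx. Qed.

Lemma mul_row3 X Y Z (A : 'M[k]_b) :
  A *m row3 X Y Z = row3 (A *m X) (A *m Y) (A *m Z).
Proof. by rewrite /row3 !mul_mx_row. Qed.

Lemma add_row3 X Y Z X' Y' Z' :
  row3 X Y Z + row3 X' Y' Z' = row3 (X + X') (Y + Y') (Z + Z').
Proof. by rewrite /row3 !add_row_mx. Qed.

Lemma scale_row3 (a : k) X Y Z :
  a *: row3 X Y Z = row3 (a *: X) (a *: Y) (a *: Z).
Proof. by rewrite /row3 !scale_row_mx. Qed.

Lemma add_col3 c (X Y Z X' Y' Z' : 'M[k]_(b, c)) :
  col3 X Y Z + col3 X' Y' Z' = col3 (X + X') (Y + Y') (Z + Z').
Proof. by rewrite /col3 !add_col_mx. Qed.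

Lemma scale_col3 c (a : k) (X Y Z : 'M[k]_(b, c)) :
  a *: col3 X Y Z = col3 (a *: X) (a *: Y) (a *: Z).
Proof. by rewrite /col3 !scale_col_mx. Qed.

Lemma add_col6 c (X Y Z S T U X' Y' Z' S' T' U' : 'M[k]_(b, c)) :
  col6 X Y Z S T U + col6 X' Y' Z' S' T' U' =
  col6 (X + X') (Y + Y') (Z + Z') (S + S') (T + T') (U + U').
Proof. by rewrite /col6 !add_col_mx. Qed.

Lemma scale_col6 c (a : k) (X Y Z S T U : 'M[k]_(b, c)) :
  a *: col6 X Y Z S T U =
  col6 (a *: X) (a *: Y) (a *: Z) (a *: S) (a *: T) (a *: U).
Proof. by rewrite /col6 !scale_col_mx. Qed.

(** The Kronecker product of [X] with the identity of size [b]. *)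
Definition scalar3 (X : 'M[k]_3) : 'M[k]_(b + (b + b)) :=
  let r i := row3 (X i 0)%:M (X i 1)%:M (X i 2%:R)%:M in
  col3 (r 0) (r 1) (r 2%:R).

Lemma scalar3M (X Y : 'M[k]_3) : scalar3 X *m scalar3 Y = scalar3 (X *m Y).
Proof.
rewrite /scalar3 mul_col3 !mul_row3_col3 !mul_row3 !add_row3.
rewrite !mxE !sum_ord3.
by rewrite -!scalar_mxM -!raddfD.
Qed.

Lemma scalar3_1 : scalar3 1%:M = 1%:M.
Proof.
apply: mulmx_rV_inj => v; rewrite mulmx1 -[v]hsubmxK -[rsubmx v]hsubmxK.
rewrite /scalar3 /row3 /col3 !mxE /= !raddf0 !mul_row_col !mul_mx_row.
by rewrite !add_row_mx !mulmx1 !mulmx0 !addr0 !add0r.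
Qed.

Lemma scalar3_unit (X : 'M[k]_3) : X \in unitmx -> scalar3 X \in unitmx.
Proof.
move=> uX; have /mulmx1_unit[] // : scalar3 X *m scalar3 (invmx X) = 1%:M.
by rewrite scalar3M mulmxV // scalar3_1.
Qed.

(* The rows of [N1 B] are indexed by the basis E_ba - E_ab of the skew matrices,
   (a, b) = (1, 2), (3, 1), (2, 3), so that the row of [S] acts by sending a_i
   to the i-th row of [S]; [skew3 X] is the matrix of S |-> X^T S X. *)
Definition skew3 (X : 'M[k]_3) : 'M[k]_(b + (b + b)) :=
  let m p q i j := (X p i * X q j - X q i * X p j)%:M in
  let r p q := row3 (m p q 1 0) (m p q 0 2%:R) (m p q 2%:R 1) in
  col3 (r 1 0) (r 0 2%:R) (r 2%:R 1).

(* The analogue of [skew3] for symmetric matrices, with the basis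
   E_12 + E_21, E_13 + E_31, E_23 + E_32, E_11, E_22, E_33. *)
Definition sym3 (X : 'M[k]_3) : 'M[k]_(b + (b + (b + (b + (b + b))))) :=
  let r (m : 'I_3 -> 'I_3 -> k) := row6 (m 0 1)%:M (m 0 2%:R)%:M (m 1 2%:R)%:M
    (m 0 0)%:M (m 1 1)%:M (m 2%:R 2%:R)%:M in
  let m p q i j := X p i * X q j + X q i * X p j in
  let d p i j := X p i * X p j in
  col6 (r (m 0 1)) (r (m 0 2%:R)) (r (m 1 2%:R))
       (r (d 0)) (r (d 1)) (r (d 2%:R)).

(** Row i of X^T S X is the sum over j of X_ji times (row j of S) X, and [B] commutes with the
    scalar blocks. The same identity serves [N2]. *)
Lemma N1_twist_hom (B : 'M[k]_b) (X : 'M[k]_3) :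
  is_hom (twist X (N1 B)) (N1 B) (skew3 X, scalar3 X).
Proof.
move=> i; rewrite /twist ffunE sum_ord3 /=; elim/ord3P: i.
all: rewrite !ffunE /= !scale_col3 !add_col3 mul_col3 mul_col3.
all: congr col3; rewrite mul_row3_col3 !mul_row3 !scale_row3 !add_row3.
all: rewrite mul_row3_col3 !mul_row3 !add_row3; congr row3.
all: rewrite !(mul_mx_scalar, mul_scalar_mx).
all: apply/matrixP => r s; rewrite !mxE; ring.
Qed.

Lemma N2_twist_hom (B : 'M[k]_b) (X : 'M[k]_3) :
  is_hom (twist X (N2 B)) (N2 B) (sym3 X, scalar3 X).
Proof.
move=> i; rewrite /twist ffunE sum_ord3 /=; elim/ord3P: i.
all: rewrite !ffunE /= !scale_col6 !add_col6 mul_col6 mul_col6.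
all: congr col6; rewrite mul_row6_col6 !mul_row3 !scale_row3 !add_row3.
all: rewrite mul_row3_col3 !mul_row3 !add_row3; congr row3.
all: rewrite !(mul_mx_scalar, mul_scalar_mx).
all: apply/matrixP => r s; rewrite !mxE; ring.
Qed.

End Blocks.

(** A row killed by [sigma.1] is killed by every arrow of the twist, hence by every arrow of [N]
    because [X] is invertible; the arrows of [N] have no common kernel. *)
Lemma unit_of_twist_hom (k : fieldType) (n b1 b2 : nat) (N : rep k n b1 b2)
    (X : 'M[k]_n) sigma :
  (forall v : 'rV_b1, (forall i, v *m N i = 0) -> v = 0) ->
  X \in unitmx -> sigma.2 \in unitmx -> is_hom (twist X N) N sigma ->
  sigma.1 \in unitmx.
Proof.
move=> Ninj uX u2 sN; rewrite -row_free_unit -kermx_eq0.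
apply/eqP/row_matrixP => r; rewrite row0; set v := row r _.
have v0 : v *m sigma.1 = 0 by rewrite -row_mul mulmx_ker row0.
have vX i : v *m twist X N i = 0.
  by rewrite -[LHS](mulmxK u2) -(mulmxA v) sN mulmxA v0 !mul0mx.
apply: Ninj => i; rewrite -(twist1 N) -(mulmxV uX) -twistM ffunE mulmx_sumr.
by rewrite big1 // => j _; rewrite -scalemxAr vX scaler0.
Qed.

Lemma skew3_unit (k : fieldType) (b : nat) (X : 'M[k]_3) :
  X \in unitmx -> skew3 b X \in unitmx.
Proof.
(* [skew3] does not involve [B], and for B = 1 the arrows of [N1] have zero common kernel. *)
move=> uX; have := N1_twist_hom (1%:M : 'M[k]_b) X.
apply: (unit_of_twist_hom _ uX); last exact: scalar3_unit.
move=> v; rewrite -[v]hsubmxK -[rsubmx v]hsubmxK => vN.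
(* The first two rows of a skew 3x3 matrix determine it. *)
move: (vN 0) (vN 1).
rewrite !ffunE /= /col3 /row3 !mul_row_col !mul_mx_row !add_row_mx.
rewrite !mulmx0 !mulmxN !mulmx1 !addr0 !add0r -!row_mx0.
move=> /eq_row_mx[_ /eq_row_mx[_ ->]] /eq_row_mx[-> /eq_row_mx[_]].
by move=> /(canRL (@opprK _)) ->; rewrite oppr0.
Qed.

Lemma sym3_unit (k : fieldType) (b : nat) (X : 'M[k]_3) :
  X \in unitmx -> sym3 b X \in unitmx.
Proof.
move=> uX; have := N2_twist_hom (1%:M : 'M[k]_b) X.
apply: (unit_of_twist_hom _ uX); last exact: scalar3_unit.
move=> v.
rewrite -[v]hsubmxK -[rsubmx v]hsubmxK -[rsubmx (rsubmx v)]hsubmxK.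
rewrite -[rsubmx (rsubmx (rsubmx v))]hsubmxK.
rewrite -[rsubmx (rsubmx (rsubmx (rsubmx v)))]hsubmxK => vN.
(* For symmetric matrices the third row is needed too, to reach the coefficient of E_33. *)
move: (vN 0) (vN 1) (vN 2%:R).
rewrite !ffunE /= /col6 /row3 !mul_row_col !mul_mx_row !add_row_mx.
rewrite !mulmx0 !mulmx1 !addr0 !add0r -!row_mx0.
move=> /eq_row_mx[-> /eq_row_mx[-> ->]] /eq_row_mx[_ /eq_row_mx[-> ->]].
by move=> /eq_row_mx[_ /eq_row_mx[_ ->]].
Qed.

Theorem proposition4p2 (k : fieldType) (char0 : [pchar k]%R =i pred0)
    (b : nat) (hb : (1 <= b)%N) :
  for_general (@pair_coord k b) (fun B : 'M[k]_b * 'M[k]_b =>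
    forall a : nat, (1 <= a)%N ->
      (forall c : rep k 3 a (2 * a) -> k,
         is_schofield (N1 B.1) c -> semi_invariant c) /\
      (forall c : rep k 3 a a -> k,
         is_schofield (N2 B.2) c -> semi_invariant c)).
Proof.
(* The open set is the whole space, where the polynomial 1 is nonzero: the isomorphisms with the
   twists are given by one formula for all [B]. *)
exists (fun=> True); split; [exists (fun p => p = 1) => B|by exists (0, 0)|].
  split=> // _; exists 1; split=> //; rewrite /peval rmorph1.
  exact/eqP/oner_neq0.
move=> B _ a _; split=> c; apply: schofield_semi_invariant => h uh.
  exists (skew3 b h, scalar3 b h); split; first exact: N1_twist_hom.
    exact: skew3_unit.
  exact: scalar3_unit.
exists (sym3 b h, scalar3 b h); split; first exact: N2_twist_hom.
  exact: sym3_unit.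
exact: scalar3_unit.
Qed.
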